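(* Let $P,Q$ be probability measures on a measurable space with densities $p,q$ with respect to a dominating measure $\lambda$, let $q_0\in(0,1)$ be a parameter, and let $\rho_{q_0}=\rho_{q_0}(P\|Q)=\int p^{q_0}q^{1-q_0}\,d\lambda$ be the Chernoff $\alpha$-coefficient with parameter $q_0$. Let $$g(\alpha)=\left(q_0^{q_0}(1-q_0)^{1-q_0}\rho_{q_0}\right)^{\frac1{q_0}}\alpha^{\frac{q_0-1}{q_0}},$$ which is an upper bound for the Neyman-Pearson boundary of $(P,Q)$, and let $h(\alpha)=-\alpha+1$ be the line of ignorance. Refining the upper bound $g$ by the lower convex envelope $\mathrm{conv}(\min\{g(\alpha),h(\alpha)\})$ results in the following upper bound for the Neyman-Pearson boundary: $$\beta\le\min\left\{\left(q_0^{q_0}(1-q_0)^{1-q_0}\rho_{q_0}\right)^{\frac1{q_0}}\alpha^{\frac{q_0-1}{q_0}},\;-\rho_{q_0}^{-\frac1{q_0}}\alpha+1,\;-\rho_{q_0}^{\frac1{q_0}}\alpha+\rho_{q_0}^{\frac1{q_0}}\right\}.$$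
   Context: The lower convex envelope $\mathrm{conv}(u)$ of a function $u$ on $[0,1]$ is the largest convex function that is pointwise $\le u$. Tests: the hypotheses are $H_0$: $x$ is a sample from $Q$, and $H_1$: $x$ is a sample from $P$. A (possibly randomized) test is a measurable $\phi:\Omega\to[0,1]$, accepting $H_0$ with probability $\phi(x)$ and $H_1$ with probability $1-\phi(x)$; its false positive rate is $\alpha=\int(1-\phi)\,dQ$ and its false negative rate is $\beta=\int\phi\,dP$. The Neyman-Pearson region is the set of all $(\alpha,\beta)$ attained by tests, and the Neyman-Pearson boundary is its lower boundary, given by the minimum $\beta$ for each $\alpha\in[0,1]$. The line of ignorance is the segment between $(0,1)$ and $(1,0)$.
   Formalization: The printed bound fails at α=1 when 0<ρ<1 (second entry negative). The line through (0,1) has slope −ρ^{-1/(1−q₀)} instead of −ρ^{-1/q₀}, and the lines count only on α≤(1−q₀)ρ^{1/(1−q₀)} and α≥1−q₀ respectively, up to their tangency points with g. *)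

(* Defs.v *)
From HB Require Import structures.
From mathcomp Require Import all_boot all_order all_algebra.
From mathcomp Require Import all_classical all_reals all_analysis.

Set Implicit Arguments.
Unset Strict Implicit.
Unset Printing Implicit Defensive.

Import Order.TTheory GRing.Theory Num.Theory.
Import numFieldNormedType.Exports.

Local Open Scope classical_set_scope.
Local Open Scope ring_scope.

Definition is_density d (T : measurableType d) (R : realType)
    (lambda : {measure set T -> \bar R}) (P : probability T R) (p : T -> R) :=
  [/\ measurable_fun setT p, forall x, 0 <= p x &
      forall A, measurable A -> P A = (\int[lambda]_(x in A) (p x)%:E)%E].

(* The integral is at most 1 by Hoelder's inequality, so taking the real-valued
   integral loses nothing. *)
Definition chernoff_coef d (T : measurableType d) (R : realType)
    (lambda : {measure set T -> \bar R}) (p q : T -> R) (q0 : R) : R :=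
  \int[lambda]_x (p x `^ q0 * q x `^ (1 - q0)).

(* [phi x] is the probability of accepting H0, i.e. that x was sampled from Q. *)
Definition is_test d (T : measurableType d) (R : realType) (phi : T -> R) :=
  measurable_fun setT phi /\ forall x, 0 <= phi x <= 1.

Definition false_positive_rate d (T : measurableType d) (R : realType)
    (Q : probability T R) (phi : T -> R) : R := \int[Q]_x (1 - phi x).

Definition false_negative_rate d (T : measurableType d) (R : realType)
    (P : probability T R) (phi : T -> R) : R := \int[P]_x phi x.

Definition NP_region d (T : measurableType d) (R : realType)
    (P Q : probability T R) : set (R * R) :=
  [set ab | exists phi : T -> R, [/\ is_test phi,
     ab.1 = false_positive_rate Q phi & ab.2 = false_negative_rate P phi]].

(* For alpha in [0, 1] the set is nonempty (take phi constant, equal to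
   1 - alpha) and bounded below by 0; the infimum is attained, by the
   Neyman-Pearson lemma. *)
Definition NP_boundary d (T : measurableType d) (R : realType)
    (P Q : probability T R) (alpha : R) : R :=
  inf [set beta | NP_region P Q (alpha, beta)].

(* [c] is the largest convex function on [0, 1] lying below [u]; the values of
   [u] and [c] outside [0, 1] are irrelevant. *)
Definition is_lower_convex_envelope (R : realType) (u : R -> \bar R)
    (c : R -> R) :=
  [/\ convex_function (`[0, 1]%classic : set R) c,
      forall a, 0 <= a <= 1 -> ((c a)%:E <= u a)%E &
      forall c' : R -> R, convex_function (`[0, 1]%classic : set R) c' ->
        (forall a, 0 <= a <= 1 -> ((c' a)%:E <= u a)%E) ->
        forall a, 0 <= a <= 1 -> c' a <= c a].

(* The exponent of alpha is negative, so the value at 0 is +oo, whereas [powR]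
   would give 0. *)
Definition hyperbolic_bound (R : realType) (q0 rho alpha : R) : \bar R :=
  if alpha == 0 then +oo%E
  else ((q0 `^ q0 * (1 - q0) `^ (1 - q0) * rho) `^ (1 / q0) *
        alpha `^ ((q0 - 1) / q0))%:E.

Definition ignorance_line (R : realType) (alpha : R) : R := - alpha + 1.

(* The tangent to [hyperbolic_bound] through (0, 1), restricted to the segment
   from (0, 1) to the point of tangency.  The abscissa of that point is
   (1 - q0) * rho `^ (1 / (1 - q0)).  If rho = 0 the segment is the single
   point (0, 1), whatever the slope. *)
Definition left_tangent_segment (R : realType) (q0 rho alpha : R) : \bar R :=
  if 0 <= alpha <= (1 - q0) * rho `^ (1 / (1 - q0))
  then (- rho `^ (- (1 / (1 - q0))) * alpha + 1)%:E else +oo%E.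

(* The tangent to [hyperbolic_bound] through (1, 0), restricted to the segment
   from the point of tangency, of abscissa 1 - q0, to (1, 0). *)
Definition right_tangent_segment (R : realType) (q0 rho alpha : R) : \bar R :=
  if 1 - q0 <= alpha <= 1
  then (- rho `^ (1 / q0) * alpha + rho `^ (1 / q0))%:E else +oo%E.

(* The restriction of the tangents to segments matters: the curve is convex, so
   each full tangent line lies below it throughout, and the minimum with the
   full lines would be below the envelope (even negative at alpha = 1 when
   0 < rho < 1).  On [0, 1] the minimum is a real number, so [fine] is only a
   type coercion. *)
Definition refined_bound (R : realType) (q0 rho alpha : R) : R :=
  fine (mine (hyperbolic_bound q0 rho alpha)
             (mine (left_tangent_segment q0 rho alpha)
                   (right_tangent_segment q0 rho alpha))).

(* Main.v *)
Require Import Defs.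
From HB Require Import structures.
From mathcomp Require Import all_boot all_order all_algebra.
From mathcomp Require Import all_classical all_reals all_analysis.
From mathcomp Require Import measurable_realfun.
From mathcomp Require Import ring lra.

Set Implicit Arguments.
Unset Strict Implicit.
Unset Printing Implicit Defensive.

Import Order.TTheory GRing.Theory Num.Theory.
Import numFieldNormedType.Exports.

Local Open Scope classical_set_scope.
Local Open Scope ring_scope.

(** The whole proof rests on the straight lines
      beta = mu ^ (1 - s) * rho - mu * alpha,     mu >= 0,   s = q0.
    They play two roles.

    First, by the weighted arithmetic-geometric mean inequality each of them
    lies below the hyperbola g, and the one of parameter mu = ((1 - s) * rho
    / alpha) ^ (1 / s) touches it at alpha ([line_le_hyperbola],
    [line_eq_hyperbola]): they are the tangents of g. The tangent through
    (0, 1) is the one with mu ^ (1 - s) * rho = 1, the tangent through (1,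
    0) the one with mu ^ (1 - s) * rho = mu. The refined bound follows g
    between the two points of tangency and these two tangents outside of
    them; for rho = 0 the hyperbola is the axis beta = 0 and the left
    segment is the point (0, 1). At every interior point it is touched by a
    tangent of g whose point of tangency is between these two; such a
    tangent passes below (0, 1) and (1, 0), so it stays below the whole
    refined bound ([line_le_refined]). Having a supporting line at each
    interior point, the refined bound is convex ([refined_bound_convex]),
    and it is below the line of ignorance because this holds at 0 and at 1.
    It is the largest convex minorant since a convex function below g and
    the line of ignorance is below each chord from an endpoint to the
    corresponding point of tangency ([refined_bound_envelope]).

    Secondly, for each mu >= 0 the likelihood ratio test that accepts H0 where
    p <= mu * q has
      beta + mu * alpha = int min (p, mu * q) d lambda
                       <= int p ^ s * (mu * q) ^ (1 - s) d lambda
                        = mu ^ (1 - s) * rho,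
    so that the Neyman-Pearson region has a point on or below each of the
    lines ([NP_region_below_line]). The Neyman-Pearson boundary is convex
    ([NP_boundary_convex]), hence has a subgradient - mu at each interior
    alpha, with mu >= 0 as the boundary is least, namely 0, at alpha = 1;
    comparing it with the test of parameter mu, the boundary at alpha is at
    most the height of the corresponding line, hence at most g alpha
    ([NP_boundary_le_hyperbola]). This argument through subgradients avoids
    exhibiting a randomized test of false positive rate exactly alpha.

    The Neyman-Pearson boundary is thus a convex function below g and the line
    of ignorance, and maximality of the envelope gives the bound. *)

(** * Convex functions on the unit interval *)

Lemma convex_function01P (R : realType) (f : R -> R) :
  convex_function (`[0, 1]%classic : set R) f <->
  forall t x y : R, 0 <= t <= 1 -> 0 <= x <= 1 -> 0 <= y <= 1 ->
    f (t * x + (1 - t) * y) <= t * f x + (1 - t) * f y.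
Proof.
split=> [cf t x y /andP[t0 t1] x01 y01|cf t x y].
  by apply: (cf (Itv01 t0 t1) x y); rewrite inE /= in_itv.
rewrite !inE /= !in_itv /= => x01 y01.
by apply: cf => //; apply/andP; split; [exact: ge0|exact: le1].
Qed.

(** Used to compare a convex function with an affine one from the values at
    the ends of an interval only. *)
Lemma convex_le_affine (R : realType) (f : R -> R) (m c x y a : R) :
  convex_function (`[0, 1]%classic : set R) f ->
  0 <= x -> y <= 1 -> x <= a <= y ->
  f x <= m * x + c -> f y <= m * y + c -> f a <= m * a + c.
Proof.
move=> /convex_function01P cf x0 y1 /andP[xa ay] fx fy.
have [xy|yx] := ltP x y; last by have -> : a = x by lra.
have yx0 : 0 < y - x by rewrite subr_gt0.
pose t := (y - a) / (y - x).
have t01 : 0 <= t <= 1.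
  by rewrite /t divr_ge0 ?subr_ge0 ?(ltW xy)//= ler_pdivrMr// mul1r; lra.
have at_ : a = t * x + (1 - t) * y by rewrite /t; field; lra.
have xy01 : 0 <= x <= 1 /\ 0 <= y <= 1 by split; lra.
have := cf t x y t01 xy01.1 xy01.2; rewrite -at_ => /le_trans; apply.
rewrite at_; case/andP: t01 => t0 t1.
have := ler_wpM2l t0 fx.
have : 0 <= 1 - t by lra.
move=> /ler_wpM2l/(_ _ _ fy); lra.
Qed.

(** Supporting lines are only asked for inside the interval: a convex
    combination equal to 0 or 1 is a trivial one.  This is what allows a convex
    function with a jump at 0, as the refined bound when [rho = 0]. *)
Lemma convex_of_support (R : realType) (f : R -> R) :
  (forall z, 0 < z < 1 -> exists m c,
     (forall x, 0 <= x <= 1 -> m * x + c <= f x) /\ f z <= m * z + c) ->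
  convex_function (`[0, 1]%classic : set R) f.
Proof.
move=> fS; apply/convex_function01P => t x y t01 x01 y01.
have [->|t0] := eqVneq t 0; first by rewrite !mul0r subr0 !mul1r !add0r.
have [->|t1] := eqVneq t 1; first by rewrite subrr !mul0r !mul1r !addr0.
have [->|xy] := eqVneq x y.
  by rewrite -!mulrDl (addrC t) subrK !mul1r.
have [tp tn] : 0 < t /\ 0 < 1 - t.
  by rewrite subr_gt0 !lt_neqAle t1 eq_sym t0; case/andP: t01 => -> ->.
set z := _ + _.
have z01 : 0 < z < 1.
  rewrite /z; case: (ltgtP x y) xy => // xy _.
    have := ltr_pM2l tp x y; have := ltr_pM2l tn x y; rewrite xy; nra.
  have := ltr_pM2l tp y x; have := ltr_pM2l tn y x; rewrite xy; nra.
have [m [c [mf fz]]] := fS z z01.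
apply: le_trans fz _; rewrite /z.
have := ler_wpM2l (ltW tp) (mf x x01).
have := ler_wpM2l (ltW tn) (mf y y01); lra.
Qed.

(** The slope is the supremum of the slopes of the chords that end at [z];
    these are bounded by the slopes of the chords that start at [z]. *)
Lemma convex_subgradient (R : realType) (f : R -> R) (z : R) :
  convex_function (`[0, 1]%classic : set R) f -> 0 < z < 1 ->
  exists m, forall x, 0 <= x <= 1 -> f z + m * (x - z) <= f x.
Proof.
move=> cf /andP[z0 z1].
pose S := [set (f z - f x) / (z - x) | x in [set x | 0 <= x < z]].
have slopes x y : 0 <= x < z -> z < y <= 1 ->
    (f z - f x) / (z - x) <= (f y - f z) / (y - z).
  move=> /andP[x0 xz] /andP[zy y1].
  have zx0 : 0 < z - x by rewrite subr_gt0.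
  have yz0 : 0 < y - z by rewrite subr_gt0.
  have yx0 : y - x != 0 by lra.
  have := @convex_le_affine R f ((f y - f x) / (y - x))
    (f x - (f y - f x) / (y - x) * x) x y z cf x0 y1.
  have -> : x <= z <= y by rewrite !ltW.
  have -> : (f y - f x) / (y - x) * x + (f x - (f y - f x) / (y - x) * x) = f x
    by ring.
  have -> : (f y - f x) / (y - x) * y + (f x - (f y - f x) / (y - x) * x) = f y
    by field.
  move=> /(_ isT (lexx _) (lexx _)) fz.
  rewrite ler_pdivrMr// mulrAC ler_pdivlMr//.
  have yx : 0 < y - x by lra.
  have : f z * (y - x) <= (f y - f x) * z + f x * (y - x) - (f y - f x) * x.
    rewrite -ler_pdivlMr//; apply: le_trans fz _.
    by rewrite le_eqVlt; apply/orP; left; apply/eqP; field.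
  lra.
have S0 : S !=set0 by exists ((f z - f 0) / (z - 0)), 0 => //=; rewrite lexx.
have ubS y : z < y <= 1 -> ubound S ((f y - f z) / (y - z)).
  by move=> yz _ [x xz <-]; exact: slopes.
have hS : has_sup S.
  by split => //; exists ((f 1 - f z) / (1 - z)); apply: ubS; rewrite z1 lexx.
exists (sup S) => x /andP[x0 x1].
case: (ltgtP x z) => [xz|zx|->]; last by rewrite subrr mulr0 addr0.
- have : (f z - f x) / (z - x) <= sup S.
    by apply: ub_le_sup; [case: hS|exists x => //=; rewrite x0].
  rewrite ler_pdivrMr ?subr_gt0//; lra.
- have : sup S <= (f x - f z) / (x - z).
    by apply: ge_sup => //; apply: ubS; rewrite zx.
  rewrite ler_pdivlMr ?subr_gt0//; lra.
Qed.

(** * The hyperbola and its tangents *)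

(** Young's inequality for the conjugate exponents [1 / s] and
    [1 / (1 - s)]. *)
Lemma powR_amgm (R : realType) (s x y : R) : 0 < s < 1 -> 0 <= x -> 0 <= y ->
  x `^ s * y `^ (1 - s) <= s * x + (1 - s) * y.
Proof.
move=> /andP[s0 s1] x0 y0.
have r0 : 0 < 1 - s by rewrite subr_gt0.
have := @conjugate_powR R (x `^ s) (y `^ (1 - s)) s^-1 (1 - s)^-1.
rewrite !powR_ge0 !invr_gt0 s0 r0 !invrK addrC subrK -!powRrM.
rewrite !mulfV ?gt_eqF// !powRr1//.
by move=> /(_ isT isT isT isT erefl); rewrite ![_ * s]mulrC ![_ * (1 - s)]mulrC.
Qed.

(** The [mu >= 0] that maximizes [mu ^ (1 - s) * rho - mu * a], that is, the
    parameter of the line that is highest at [a]. *)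
Definition tangent_slope (R : realType) (s rho a : R) : R :=
  ((1 - s) * rho / a) `^ (1 / s).

(** The value of [hyperbolic_bound] away from 0, as a real number. *)
Definition hyperbola (R : realType) (s rho a : R) : R :=
  (s `^ s * (1 - s) `^ (1 - s) * rho) `^ (1 / s) * a `^ ((s - 1) / s).

Section hyperbola_tangents.
Context {R : realType}.
Implicit Types s rho mu a : R.

Lemma tangent_slopeX s rho a : 0 < s < 1 -> 0 <= rho -> 0 < a ->
  a * tangent_slope s rho a `^ s = (1 - s) * rho.
Proof.
move=> /andP[s0 s1] r0 a0.
rewrite /tangent_slope -powRrM divfK ?gt_eqF// powRr1.
  by field; exact: lt0r_neq0.
by rewrite divr_ge0 ?(ltW a0)// mulr_ge0 // subr_ge0 ltW.
Qed.

(** The constant in the hyperbola is what makes it, at each abscissa, the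
    fraction [s] of the intercept of its tangent. *)
Lemma hyperbolaE s rho a : 0 < s < 1 -> 0 <= rho -> 0 < a ->
  hyperbola s rho a = s * (tangent_slope s rho a `^ (1 - s) * rho).
Proof.
move=> /andP[s0 s1] r0 a0.
have c0 : 0 <= 1 - s by rewrite subr_ge0 ltW.
rewrite /hyperbola /tangent_slope -powRrM.
rewrite powRM ?mulr_ge0 ?powR_ge0// powRM ?powR_ge0// -!powRrM.
rewrite [s * (1 / s)](_ : _ = 1); last by field; exact: lt0r_neq0.
rewrite powRr1 ?(ltW s0)// [1 / s * _](_ : _ = (1 - s) * (1 / s)); last by ring.
set e := (1 - s) * (1 / s).
have -> : (s - 1) / s = - e by rewrite /e; ring.
rewrite powRM ?mulr_ge0 ?invr_ge0 ?(ltW a0)// powRM// -(powR_inv1 (ltW a0)).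
rewrite -powRrM mulN1r.
rewrite -(@mulr_powRB1 _ rho (1 / s))// ?divr_gt0//.
have -> : 1 / s - 1 = e by rewrite /e; field; exact: lt0r_neq0.
ring.
Qed.

(** After multiplication by [nu ^ s], for [nu] the tangent slope, this is the
    weighted arithmetic-geometric mean inequality for [nu] and [mu]. *)
Lemma line_le_hyperbola s rho mu a :
  0 < s < 1 -> 0 <= rho -> 0 <= mu -> 0 < a ->
  mu `^ (1 - s) * rho - mu * a <= hyperbola s rho a.
Proof.
move=> s01 r0 m0 a0.
rewrite hyperbolaE//; have := tangent_slopeX s01 r0 a0.
set nu := tangent_slope s rho a => nuE.
have nu0 : 0 <= nu by exact: powR_ge0.
have [rho0|rho0] := eqVneq rho 0.
  by rewrite rho0 !mulr0 sub0r oppr_le0 mulr_ge0 // ltW.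
have rp : 0 < rho by rewrite lt_neqAle eq_sym rho0.
have np : 0 < nu.
  by apply: powR_gt0; rewrite divr_gt0 ?mulr_gt0 ?subr_gt0//; case/andP: s01.
have nsp : 0 < nu `^ s by exact: powR_gt0.
rewrite -(ler_pM2r nsp).
have -> : s * (nu `^ (1 - s) * rho) * nu `^ s = s * nu * rho.
  have -> : s * nu * rho = s * (nu `^ (1 - s + s)) * rho.
    by rewrite subrK powRr1.
  by rewrite (@powRD _ _ (1 - s) s) ?(gt_eqF np) ?implybT//; ring.
have -> : (mu `^ (1 - s) * rho - mu * a) * nu `^ s =
   (nu `^ s * mu `^ (1 - s) - (1 - s) * mu) * rho.
  by rewrite mulrBl -(mulrA mu) nuE; ring.
rewrite ler_pM2r//; have := powR_amgm s01 nu0 m0; lra.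
Qed.

Lemma line_eq_hyperbola s rho a : 0 < s < 1 -> 0 <= rho -> 0 < a ->
  tangent_slope s rho a `^ (1 - s) * rho - tangent_slope s rho a * a =
  hyperbola s rho a.
Proof.
move=> s01 r0 a0.
rewrite hyperbolaE//; have := tangent_slopeX s01 r0 a0.
set nu := tangent_slope s rho a => nuE.
have -> : nu * a = nu `^ (1 - s) * (a * nu `^ s).
  rewrite mulrCA -powRD ?subrK ?powRr1 ?powR_ge0//; first by ring.
  by rewrite oner_eq0.
rewrite nuE; ring.
Qed.

End hyperbola_tangents.

(** * The refined bound is a convex envelope *)

Section refined.
Context {R : realType}.
Variables (s rho : R).
Hypotheses (s01 : 0 < s < 1) (rho01 : 0 <= rho <= 1).
Implicit Types a mu v x z : R.

Let s0 : 0 < s. Proof. by case/andP: s01. Qed.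
Let r0 : 0 < 1 - s. Proof. by rewrite subr_gt0; case/andP: s01. Qed.
Let rho0 : 0 <= rho. Proof. by case/andP: rho01. Qed.

(** The left tangent segment has slope [- mL] and ends at [a0], the right one
    has slope [- mR] and starts at [1 - s]. *)
Local Notation a0 := ((1 - s) * rho `^ (1 / (1 - s))).
Local Notation mL := (rho `^ (- (1 / (1 - s)))).
Local Notation mR := (rho `^ (1 / s)).
Local Notation f := (refined_bound s rho).

(** The minimum that defines the refined bound is a real number on the unit
    interval, so that [fine] can be dropped: at 0 the left segment is finite,
    elsewhere the hyperbola is. *)
Lemma le_refined_boundE v a : 0 <= a <= 1 ->
  (v <= f a) = [&& (0 < a) ==> (v <= hyperbola s rho a),
                   (a <= a0) ==> (v <= - mL * a + 1) &
                   (1 - s <= a) ==> (v <= - mR * a + mR)].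
Proof.
move=> /andP[a_ge0 a_le1].
rewrite -lee_fin /refined_bound fineK.
  rewrite !le_min /hyperbolic_bound /left_tangent_segment.
  rewrite /right_tangent_segment a_ge0 a_le1 andbT /= lt_neqAle a_ge0 andbT.
  rewrite eq_sym -/(hyperbola s rho a).
  by congr [&& _, _ & _]; case: ifP; rewrite ?implybF ?lee_fin ?leey.
rewrite fin_numElt; apply/andP; split.
  rewrite !lt_min /hyperbolic_bound /left_tangent_segment.
  rewrite /right_tangent_segment.
  by apply/and3P; split; case: ifP; rewrite ?ltNyr ?ltNye.
rewrite !gt_min /hyperbolic_bound /left_tangent_segment.
have [->|an0] := eqVneq a 0; last by rewrite ltry.
by rewrite lexx mulr_ge0 ?powR_ge0 ?(ltW r0)//= ltry ?orbT.
Qed.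

(** The intercept of the line of slope [- mL] is 1: this is the tangent
    through (0, 1). *)
Lemma left_slope_line : 0 < rho -> mL `^ (1 - s) * rho = 1.
Proof.
move=> rp; rewrite -powRrM mulNr divfK ?gt_eqF// powRN powRr1//.
by rewrite mulVf ?gt_eqF.
Qed.

(** The intercept of the line of slope [- mR] is [mR]: this is the tangent
    through (1, 0). *)
Lemma right_slope_line : mR `^ (1 - s) * rho = mR.
Proof.
rewrite -powRrM -[RHS]mulr_powRB1 ?divr_gt0// mulrC; congr (_ * _ `^ _).
by field; exact: lt0r_neq0.
Qed.

Lemma tangent_slope_left : 0 < rho -> tangent_slope s rho a0 = mL.
Proof.
move=> rp; rewrite /tangent_slope invfM mulrACA mulfV ?gt_eqF// mul1r.
rewrite -powRN -{1}(powRr1 rho0) -powRD ?(gt_eqF rp) ?implybT// !mul1r -powRrM.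
by congr (_ `^ _); field; rewrite !gt_eqF.
Qed.

Lemma tangent_slope_right : tangent_slope s rho (1 - s) = mR.
Proof. by rewrite /tangent_slope mulrAC mulfV ?gt_eqF// !mul1r. Qed.

Lemma tangent_slope_anti a z : 0 < a -> a <= z ->
  tangent_slope s rho z <= tangent_slope s rho a.
Proof.
move=> a_gt0 az; have z_gt0 := lt_le_trans a_gt0 az.
apply: ge0_ler_powR; rewrite ?nnegrE ?divr_ge0 ?mulr_ge0 ?(ltW r0) ?(ltW s0)//.
  exact: ltW.
  exact: ltW.
by rewrite ler_wpM2l ?mulr_ge0 ?(ltW r0)// lef_pV2 ?posrE.
Qed.

Lemma left_abscissa_le : a0 <= 1 - s.
Proof.
have /andP[_ rho1] := rho01.
have : rho `^ (1 / (1 - s)) <= 1 `^ (1 / (1 - s)).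
  by apply: ge0_ler_powR; rewrite ?nnegrE ?divr_ge0// ltW.
by rewrite powR1 => ?; rewrite ger_pMr.
Qed.

Lemma left_abscissa_gt0 : 0 < a0 -> 0 < rho.
Proof.
rewrite pmulr_rgt0// => p0; rewrite lt_neqAle rho0 andbT eq_sym.
by apply: contraTneq p0 => ->; rewrite powR0 ?ltxx// gt_eqF// divr_gt0.
Qed.

Lemma hyperbola_left : 0 < a0 -> hyperbola s rho a0 = - mL * a0 + 1.
Proof.
move=> a00; have rp := left_abscissa_gt0 a00.
rewrite -line_eq_hyperbola// tangent_slope_left// left_slope_line//; ring.
Qed.

Lemma hyperbola_right : hyperbola s rho (1 - s) = - mR * (1 - s) + mR.
Proof.
rewrite -line_eq_hyperbola// tangent_slope_right// right_slope_line//; ring.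
Qed.

(** The two hypotheses on the intercept say that the line passes below (0, 1)
    and (1, 0).  Being below the hyperbola too, it is below each tangent segment
    at both ends of that segment. *)
Lemma line_le_refined mu x : 0 <= mu ->
  mu `^ (1 - s) * rho <= 1 -> mu `^ (1 - s) * rho <= mu -> 0 <= x <= 1 ->
  - mu * x + mu `^ (1 - s) * rho <= f x.
Proof.
move=> mu0 c1 cmu x01; have /andP[x0 x1] := x01.
rewrite le_refined_boundE//; set c := _ * rho in c1 cmu *.
have hypP a : 0 < a -> - mu * a + c <= hyperbola s rho a.
  by move=> a_gt0; rewrite addrC mulNr; exact: line_le_hyperbola.
apply/and3P; split; apply/implyP; first exact: hypP.
- move=> xa0; have [mLmu|mumL] := lerP mL mu.
    have : 0 <= (mu - mL) * x by rewrite mulr_ge0 // subr_ge0.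
    lra.
  have [a00|a00] := ltP 0 a0; last first.
    have -> : x = 0 by lra.
    by rewrite !mulr0 !add0r.
  have := hypP _ a00; rewrite hyperbola_left// => ha0.
  have : 0 <= (mL - mu) * (a0 - x) by rewrite mulr_ge0 // subr_ge0 // ltW.
  lra.
- move=> sx; have [mRmu|mumR] := lerP mR mu; last first.
    have : 0 <= (mR - mu) * (1 - x) by rewrite mulr_ge0 // subr_ge0 // ltW.
    lra.
  have := hypP _ r0; rewrite hyperbola_right => hr.
  have : 0 <= (mu - mR) * (x - (1 - s)) by rewrite mulr_ge0 // subr_ge0.
  lra.
Qed.

(** A tangent whose point of tangency is between those of the two extreme
    tangents passes below (0, 1) and (1, 0). *)
Lemma tangent_slope_admissible z : 0 < z -> a0 <= z <= 1 - s ->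
  let mu := tangent_slope s rho z in
  [/\ 0 <= mu, mu `^ (1 - s) * rho <= 1 & mu `^ (1 - s) * rho <= mu].
Proof.
move=> z0 /andP[az zs] mu; have mu0 : 0 <= mu by exact: powR_ge0.
split => //.
- have [->|rn0] := eqVneq rho 0; first by rewrite mulr0.
  have rp : 0 < rho by rewrite lt_neqAle eq_sym rn0.
  have a00 : 0 < a0 by rewrite mulr_gt0 ?powR_gt0.
  apply: (@le_trans _ _ (mL `^ (1 - s) * rho)); last by rewrite left_slope_line.
  apply: (ler_wpM2r rho0).
  apply: ge0_ler_powR; rewrite ?nnegrE ?powR_ge0 ?(ltW r0)//.
  by rewrite -(tangent_slope_left rp) tangent_slope_anti.
- have -> : mu `^ (1 - s) * rho = mu * (z / (1 - s)).
    have -> : rho = z / (1 - s) * mu `^ s.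
      by rewrite mulrAC tangent_slopeX// mulrAC mulfV ?mul1r// gt_eqF.
    rewrite mulrCA -powRD ?subrK ?powRr1// 1?mulrC//.
    by rewrite oner_eq0.
  by rewrite ler_piMr// ler_pdivrMr// mul1r.
Qed.

Lemma refined_boundP a : 0 <= a <= 1 ->
  [/\ 0 < a -> f a <= hyperbola s rho a, a <= a0 -> f a <= - mL * a + 1 &
      1 - s <= a -> f a <= - mR * a + mR].
Proof.
move=> a01; have := lexx (f a); rewrite le_refined_boundE// => /and3P[*].
by split; apply/implyP.
Qed.

Lemma refined_bound0_le1 : f 0 <= 1.
Proof.
have [|_ + _] := @refined_boundP 0; first by rewrite lexx ler01.
by rewrite mulr0 add0r; apply; rewrite mulr_ge0 ?powR_ge0// ltW.
Qed.

Lemma refined_bound1_le0 : f 1 <= 0.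
Proof.
have [|_ _] := @refined_boundP 1; first by rewrite lexx ler01.
by rewrite mulr1 addNr; apply; rewrite gerBl ltW.
Qed.

(** The supporting line at [z] is the tangent of the hyperbola at the point
    nearest to [z] of the interval on which the refined bound follows the
    hyperbola.  When [rho = 0] that interval starts at 0, which costs nothing
    since [z] is positive. *)
Lemma refined_bound_convex : convex_function (`[0, 1]%classic : set R) f.
Proof.
apply: convex_of_support => z /andP[z0 z1].
have [|fh fL fR] := @refined_boundP z; first by rewrite !ltW.
suff [w [w0 wI fz]] : exists w, [/\ 0 < w, a0 <= w <= 1 - s &
    f z <= - tangent_slope s rho w * z +
           tangent_slope s rho w `^ (1 - s) * rho].
  have [mu0 c1 cmu] := tangent_slope_admissible w0 wI.
  by do 2 eexists; split; last exact: fz; move=> x; exact: line_le_refined.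
have [za|az] := leP z a0.
  have a00 := lt_le_trans z0 za; have rp := left_abscissa_gt0 a00.
  exists a0; rewrite lexx left_abscissa_le; split => //.
  by rewrite tangent_slope_left// left_slope_line// fL.
have [sz|zs] := leP (1 - s) z.
  exists (1 - s); rewrite lexx left_abscissa_le; split => //.
  by rewrite tangent_slope_right right_slope_line fR.
exists z; split => //; first by rewrite !ltW.
by rewrite addrC mulNr line_eq_hyperbola// fh.
Qed.

(** A convex function below both curves is at most 1 at 0, at most 0 at 1, and
    below the hyperbola at the points of tangency, so it is below the chords
    that join these points, which are the tangent segments. *)
Lemma refined_bound_envelope : is_lower_convex_envelope
  (fun a => mine (hyperbolic_bound s rho a) (ignorance_line a)%:E) f.
Proof.
split; first exact: refined_bound_convex.
- move=> a a01; have [fh _ _] := refined_boundP a01; have /andP[ag0 a1] := a01.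
  rewrite le_min lee_fin; apply/andP; split.
    rewrite /hyperbolic_bound; have [_|an0] := eqVneq a 0; first exact: leey.
    by rewrite lee_fin; apply: fh; rewrite lt_neqAle eq_sym an0.
  rewrite /ignorance_line -(mulN1r a).
  apply: (convex_le_affine refined_bound_convex (lexx 0) (lexx 1) a01).
    by rewrite mulr0 add0r refined_bound0_le1.
  by rewrite mulr1 addNr refined_bound1_le0.
- move=> c cc cu a a01; have /andP[ag0 a1] := a01.
  have ch x : 0 < x <= 1 -> c x <= hyperbola s rho x.
    move=> /andP[x0 x1]; have := cu x; rewrite (ltW x0) x1 => /(_ isT).
    by rewrite /hyperbolic_bound gt_eqF// le_min lee_fin => /andP[].
  have cl x : 0 <= x <= 1 -> c x <= - x + 1.
    by move=> /cu; rewrite le_min !lee_fin => /andP[].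
  have c0 : c 0 <= 1 by have := cl 0; rewrite oppr0 add0r lexx ler01; exact.
  have c1 : c 1 <= 0 by have := cl 1; rewrite addNr lexx ler01; exact.
  have sle1 : 1 - s <= 1 by rewrite gerBl ltW.
  rewrite le_refined_boundE//; apply/and3P; split; apply/implyP => Ha.
  + by apply: ch; rewrite Ha.
  + have [a00|a00] := ltP 0 a0; last first.
      have -> : a = 0 by apply/le_anti; rewrite ag0 (le_trans Ha a00).
      by rewrite mulr0 add0r.
    have a0le1 := le_trans left_abscissa_le sle1.
    apply: (@convex_le_affine _ c _ _ 0 a0 _ cc) => //; first by rewrite ag0.
      by rewrite mulr0 add0r.
    by rewrite -hyperbola_left// ch// a00.
  + apply: (@convex_le_affine _ c _ _ (1 - s) 1 _ cc) => //.
    * exact: ltW.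
    * by rewrite Ha.
    * by rewrite -hyperbola_right ch// r0.
    * by rewrite mulr1 addNr.
Qed.

End refined.

(** * The Neyman-Pearson region *)

Section region.
Context {d : measure_display} {T : measurableType d} {R : realType}.
Variables P Q : probability T R.
Implicit Types (a b t : R) (phi : T -> R).

Lemma test_integrable (mu : probability T R) phi : is_test phi ->
  mu.-integrable setT (EFin \o phi).
Proof.
move=> [mphi phi01]; apply: measurable_bounded_integrable => //.
  exact: (le_lt_trans (probability_le1 mu measurableT) (ltry _)).
exists 1; split; first exact: num_real.
move=> M M1 x _ /=; have /andP[p0 p1] := phi01 x.
by rewrite ger0_norm// (le_trans p1)// ltW.
Qed.

Lemma is_testC phi : is_test phi -> is_test (fun x => 1 - phi x).
Proof.
move=> [mphi phi01]; split; first exact: measurable_funB.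
by move=> x; have := phi01 x; lra.
Qed.

Lemma Rintegral_mix (mu : probability T R) t phi psi :
  is_test phi -> is_test psi ->
  \int[mu]_x (t * phi x + (1 - t) * psi x) =
  t * \int[mu]_x phi x + (1 - t) * \int[mu]_x psi x.
Proof.
move=> tphi tpsi.
have iphi := test_integrable mu tphi; have ipsi := test_integrable mu tpsi.
rewrite RintegralD ?RintegralZl//.
  exact: (integrableZl measurableT t iphi).
exact: (integrableZl measurableT (1 - t) ipsi).
Qed.

Lemma NP_region_mix t a b a' b' : 0 <= t <= 1 ->
  NP_region P Q (a, b) -> NP_region P Q (a', b') ->
  NP_region P Q (t * a + (1 - t) * a', t * b + (1 - t) * b').
Proof.
move=> t01 [phi [tphi /= -> ->]] [psi [tpsi /= -> ->]].
exists (fun x => t * phi x + (1 - t) * psi x); split => /=.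
- split.
    apply: measurable_funD; apply: measurable_funM => //;
      [exact: tphi.1|exact: tpsi.1].
  by move=> x; have := tphi.2 x; have := tpsi.2 x; nra.
- rewrite /false_positive_rate -Rintegral_mix; try exact: is_testC.
  by apply: eq_Rintegral => x _; ring.
- by rewrite /false_negative_rate Rintegral_mix.
Qed.

Lemma Rintegral_cst_probability (mu : probability T R) c :
  \int[mu]_x c = c.
Proof.
by rewrite (Rintegral_cst mu measurableT) [X in fine X]probability_setT mulr1.
Qed.

Lemma NP_region_cst a : 0 <= a <= 1 -> NP_region P Q (a, 1 - a).
Proof.
move=> a01; exists (fun=> 1 - a); split => /=.
- by split => // x /=; lra.
- by rewrite /false_positive_rate /= Rintegral_cst_probability subKr.
- by rewrite /false_negative_rate /= Rintegral_cst_probability.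
Qed.

(** The deterministic test that accepts H0 on [A]. *)
Lemma NP_region_set (A : set T) : measurable A ->
  NP_region P Q (fine (Q (~` A)), fine (P A)).
Proof.
move=> mA; exists (\1_A : T -> R); split => /=.
- split => // x; rewrite indicE; case: (_ \in _); rewrite /= ?lexx ler01//.
- rewrite /false_positive_rate /Rintegral; congr fine.
  transitivity (\int[Q]_x (\1_(~` A) x)%:E)%E.
    by rewrite integral_indic ?setIT//; exact: measurableC.
  apply: eq_integral => x _; rewrite !indicE in_setC.
  by case: (x \in A); rewrite ?subrr ?subr0.
- by rewrite /false_negative_rate /Rintegral integral_indic// setIT.
Qed.

Lemma NP_region_ge0 a b : NP_region P Q (a, b) -> 0 <= b.
Proof.
move=> [phi [[_ phi01] /= _ ->]]; apply: Rintegral_ge0 => x _.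
by case/andP: (phi01 x).
Qed.

Lemma NP_boundary_le a b : NP_region P Q (a, b) -> NP_boundary P Q a <= b.
Proof.
move=> ab; apply: ge_inf => //; exists 0 => b' /=; exact: NP_region_ge0.
Qed.

Lemma NP_boundary_le_ignorance a : 0 <= a <= 1 -> NP_boundary P Q a <= 1 - a.
Proof. by move=> a01; apply: NP_boundary_le; exact: NP_region_cst. Qed.

(** Randomizing between two tests makes the region convex; the boundary, its
    lower edge, inherits this. *)
Lemma NP_boundary_convex :
  convex_function (`[0, 1]%classic : set R) (NP_boundary P Q).
Proof.
apply/convex_function01P => t x y t01 x01 y01.
have hinf a : 0 <= a <= 1 -> has_inf [set b | NP_region P Q (a, b)].
  move=> a01; split; first by exists (1 - a); exact: NP_region_cst.
  by exists 0 => b; exact: NP_region_ge0.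
apply/ler_addgt0Pr => e e0.
have [b bx be] := inf_adherent e0 (hinf x x01).
have [b' by' be'] := inf_adherent e0 (hinf y y01).
apply: le_trans (NP_boundary_le (NP_region_mix t01 bx by')) _.
rewrite -/(NP_boundary P Q x) in be; rewrite -/(NP_boundary P Q y) in be'.
nra.
Qed.

(** [F mu] bounds the infimum of [b + mu * a'] over the region, the negative of
    the convex conjugate of the boundary at [- mu]; the boundary is recovered
    from its conjugate by taking for [- mu] a subgradient at [a].  A positive
    subgradient is replaced by 0: the boundary vanishes at 1, so it would have
    to be negative at [a]. *)
Lemma NP_boundary_le_conjugate (F : R -> R) a : 0 < a < 1 ->
  (forall mu, 0 <= mu -> exists a' b,
     [/\ 0 <= a' <= 1, NP_region P Q (a', b) & b + mu * a' <= F mu]) ->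
  exists2 mu, 0 <= mu & NP_boundary P Q a <= F mu - mu * a.
Proof.
move=> a01 FP; have [m mP] := convex_subgradient NP_boundary_convex a01.
have [m0|m0] := leP m 0.
  have [|a' [b [a'01 ab bF]]] := FP (- m); first by rewrite oppr_ge0.
  exists (- m); first by rewrite oppr_ge0.
  by have := mP a' a'01; have := NP_boundary_le ab; nra.
have [a' [b [a'01 ab bF]]] := FP 0 (lexx 0).
exists 0 => //; have := mP 1; have := @NP_boundary_le_ignorance 1.
rewrite lexx ler01 => /(_ isT) N1 /(_ isT).
have := NP_region_ge0 ab; nra.
Qed.

End region.

(** * The likelihood ratio tests and the Chernoff coefficient *)

Section chernoff.
Context {R : realType}.

Lemma le_powR_geom_mean (s x y z : R) :
  0 < s < 1 -> 0 <= z -> z <= x -> z <= y ->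
  z <= x `^ s * y `^ (1 - s).
Proof.
move=> /andP[s0 s1] z0 zx zy.
have -> : z = z `^ s * z `^ (1 - s).
  by rewrite -powRD addrC subrK ?powRr1 ?oner_eq0.
have h (u w e : R) : 0 <= e -> 0 <= u -> u <= w -> u `^ e <= w `^ e.
  by move=> e0 u0 uw; apply: ge0_ler_powR; rewrite ?nnegrE// (le_trans u0).
by apply: ler_pM; rewrite ?powR_ge0// h// ?subr_ge0 ltW.
Qed.

Context {d : measure_display} {T : measurableType d}.
Variables (lambda : {measure set T -> \bar R}) (P Q : probability T R).
Variables (p q : T -> R) (s : R).
Hypotheses (hp : is_density lambda P p) (hq : is_density lambda Q q).
Hypothesis s01 : 0 < s < 1.

Let mp : measurable_fun setT p. Proof. by case: hp. Qed.
Let mq : measurable_fun setT q. Proof. by case: hq. Qed.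
Let p0 x : 0 <= p x. Proof. by case: hp. Qed.
Let q0 x : 0 <= q x. Proof. by case: hq. Qed.
Let PE A : measurable A -> P A = (\int[lambda]_(x in A) (p x)%:E)%E.
Proof. by case: hp => _ _; apply. Qed.
Let QE A : measurable A -> Q A = (\int[lambda]_(x in A) (q x)%:E)%E.
Proof. by case: hq => _ _; apply. Qed.
Let s0 : 0 <= s. Proof. by case/andP: s01 => /ltW. Qed.
Let r0 : 0 <= 1 - s. Proof. by case/andP: s01 => _ /ltW; rewrite subr_ge0. Qed.

Local Notation rho := (chernoff_coef lambda p q s).
Local Notation g := (fun x => p x `^ s * q x `^ (1 - s)).

Let mg : measurable_fun setT g.
Proof.
apply: measurable_funM.
  exact: (measurableT_comp (measurable_powR s) mp).
exact: (measurableT_comp (measurable_powR (1 - s)) mq).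
Qed.

Let g0 x : 0 <= g x. Proof. by rewrite mulr_ge0 ?powR_ge0. Qed.

Let integral_le1 : (\int[lambda]_x (g x)%:E <= 1)%E.
Proof.
have -> : (1 = \int[lambda]_x (s * p x + (1 - s) * q x)%:E :> \bar R)%E.
  under eq_integral do rewrite EFinD !EFinM.
  rewrite ge0_integralD//.
  - rewrite !ge0_integralZl_EFin//.
    + rewrite -PE// -QE// (probability_setT P) (probability_setT Q).
      by rewrite !mule1 -EFinD addrC subrK.
    + by move=> x _; rewrite lee_fin.
    + exact/measurable_EFinP.
    + by move=> x _; rewrite lee_fin.
    + exact/measurable_EFinP.
  - by move=> x _; rewrite -EFinM lee_fin mulr_ge0.
  - by apply/measurable_EFinP; exact: measurable_funM.
  - by move=> x _; rewrite -EFinM lee_fin mulr_ge0.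
  - by apply/measurable_EFinP; exact: measurable_funM.
apply: ge0_le_integral => //.
- by move=> x _; rewrite lee_fin.
- exact/measurable_EFinP.
- by apply/measurable_EFinP; apply: measurable_funD; exact: measurable_funM.
- by move=> x _; rewrite lee_fin powR_amgm.
Qed.

Let chernoff_coefE : (\int[lambda]_x (g x)%:E = rho%:E)%E.
Proof.
rewrite /chernoff_coef /Rintegral fineK// ge0_fin_numE.
  exact: le_lt_trans integral_le1 (ltry _).
by apply: integral_ge0 => x _; rewrite lee_fin.
Qed.

(** The upper bound is Hoelder's inequality for two densities, here obtained by
    integrating the weighted arithmetic-geometric mean inequality for
    [p x] and [q x]. *)
Lemma chernoff_coef01 : 0 <= rho <= 1.
Proof.
apply/andP; split; first by apply: Rintegral_ge0 => x _; exact: g0.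
by rewrite -lee_fin -chernoff_coefE.
Qed.

(** The likelihood ratio test of threshold [mu]: where [p <= mu * q] it pays
    [p], elsewhere [mu * q], hence everywhere the minimum of the two, which is
    at most their weighted geometric mean. *)
Lemma NP_region_below_line mu : 0 <= mu -> exists a b,
  [/\ 0 <= a <= 1, NP_region P Q (a, b) & b + mu * a <= mu `^ (1 - s) * rho].
Proof.
move=> mu0.
pose A := [set x | p x <= mu * q x].
have mA : measurable A.
  have -> : A = (fun x => mu * q x - p x) @^-1` `[0, +oo[%classic.
    by apply/seteqP; split => x /=; rewrite in_itv/= andbT subr_ge0.
  rewrite -[X in measurable X]setTI.
  have : measurable_fun setT (fun x => mu * q x - p x).
    by apply: measurable_funB => //; exact: measurable_funM.
  by apply => //; exact: measurable_itv.
have mAC := measurableC mA.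
exists (fine (Q (~` A))), (fine (P A)); split.
- rewrite -!lee_fin fineK ?fin_num_measure//.
  by rewrite measure_ge0 probability_le1.
- exact: NP_region_set.
rewrite -lee_fin EFinD !EFinM -chernoff_coefE !fineK ?fin_num_measure//.
rewrite PE// QE// -!ge0_integralZl_EFin//; first last.
- by apply/measurable_EFinP; exact: measurable_funTS.
- by move=> x _; rewrite lee_fin.
- exact: powR_ge0.
- exact/measurable_EFinP.
- by move=> x _; rewrite lee_fin.
have mgm : measurable_fun setT (fun x => (mu `^ (1 - s))%:E * (g x)%:E)%E.
  by apply/measurable_EFinP; exact: measurable_funM.
(* [A] is where [p] is the smaller of [p] and [mu * q]. *)
rewrite -(setUv A) ge0_integral_setU//; first last.
- by rewrite disj_set2E setICr.
- by move=> x _; rewrite -EFinM lee_fin mulr_ge0 ?powR_ge0.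
- by rewrite setUv.
have gE x : mu `^ (1 - s) * g x = p x `^ s * (mu * q x) `^ (1 - s).
  by rewrite powRM//; ring.
apply: leeD; apply: ge0_le_integral => //.
- by move=> x _; rewrite lee_fin.
- by apply/measurable_EFinP; exact: measurable_funTS.
- exact: measurable_funTS.
- move=> x Ax; rewrite -EFinM lee_fin gE.
  by apply: le_powR_geom_mean.
- by move=> x _; rewrite -EFinM lee_fin mulr_ge0.
- apply/measurable_EFinP; apply: measurable_funM => //.
  exact: measurable_funTS.
- exact: measurable_funTS.
- move=> x /negP; rewrite -ltNge => /ltW Ax; rewrite -!EFinM lee_fin gE.
  by apply: le_powR_geom_mean => //; rewrite mulr_ge0.
Qed.

Lemma NP_boundary_le_hyperbola a : 0 < a <= 1 ->
  NP_boundary P Q a <= hyperbola s rho a.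
Proof.
move=> /andP[a_gt0]; rewrite le_eqVlt => /orP[/eqP a1|a1].
  have := @NP_boundary_le_ignorance _ _ _ P Q a; rewrite a1 subrr lexx ler01.
  by move=> /(_ isT) /le_trans; apply; rewrite /hyperbola mulr_ge0 ?powR_ge0.
have a01 : 0 < a < 1 by rewrite a_gt0.
have [mu mu0 /le_trans] :=
  NP_boundary_le_conjugate a01 (fun mu => @NP_region_below_line mu).
by apply; apply: line_le_hyperbola => //; case/andP: chernoff_coef01.
Qed.

End chernoff.

Theorem theorem3 (d : measure_display) (T : measurableType d) (R : realType)
    (lambda : {measure set T -> \bar R}) (P Q : probability T R)
    (p q : T -> R) (q0 : R)
    (hp : is_density lambda P p) (hq : is_density lambda Q q)
    (hq0 : 0 < q0 < 1) :
  let rho := chernoff_coef lambda p q q0 in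
  is_lower_convex_envelope
    (fun a : R => mine (hyperbolic_bound q0 rho a) (ignorance_line a)%:E)
    (refined_bound q0 rho)
  /\ (forall alpha : R, 0 <= alpha <= 1 ->
        NP_boundary P Q alpha <= refined_bound q0 rho alpha).
Proof.
move=> rho; have rho01 : 0 <= rho <= 1 by exact: chernoff_coef01 hp hq hq0.
have env := refined_bound_envelope hq0 rho01.
split; first exact: env.
case: env => _ _; apply; first exact: NP_boundary_convex.
move=> a a01; rewrite le_min lee_fin; apply/andP; split.
  rewrite /hyperbolic_bound; have [_|an0] := eqVneq a 0; first exact: leey.
  rewrite lee_fin; apply: (NP_boundary_le_hyperbola hp hq hq0).
  by move: a01; rewrite lt_neqAle eq_sym an0.
by rewrite /ignorance_line addrC; exact: NP_boundary_le_ignorance.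
Qed.
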